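(* $\mathrm{GRA}(e,p,s,\setminus,\dot\cap,\exists)$ and the guarded fragment $\mathrm{GF}$ are sententially equiexpressive; that is, every sentence of $\mathrm{GF}$ has an equivalent term of $\mathrm{GRA}(e,p,s,\setminus,\dot\cap,\exists)$, and every term of $\mathrm{GRA}(e,p,s,\setminus,\dot\cap,\exists)$ of arity $0$ has an equivalent sentence of $\mathrm{GF}$.
   Context: AD-relations. $A^0=\{\epsilon\}$, with $\epsilon$ the empty tuple. A $k$-ary AD-relation over a set $A$ is a pair $(R,k)$ with $R\subseteq A^k$, $k\ge 0$; $t\in(R,k)$ means $t\in R$. Vocabularies contain only relation symbols (of any arity $k\ge 0$). Models have nonempty domains; $A$ is the domain of $\mathfrak{A}$. Terms. $\mathrm{GRA}(e,p,s,\setminus,\dot\cap,\exists)$ is the set of terms built from relation symbols and the constant $e$ by the unary operators $p,s,\exists$ and the binary operators $\setminus,\dot\cap$. Each term $\mathcal{T}$ defines in each model $\mathfrak{A}$ an AD-relation $\mathcal{T}^{\mathfrak{A}}$ of arity $\mathit{ar}(\mathcal{T})$. Let $k=\mathit{ar}(\mathcal{T})$, $\ell=\mathit{ar}(\mathcal{S})$, $m=\max\{k,\ell\}$. - $R^{\mathfrak{A}}$ is the interpretation of $R$, paired with the arity of $R$; $e^{\mathfrak{A}}=(\{(a,a)\mid a\in A\},2)$. - If $k\ge2$: $(p\mathcal{T})^{\mathfrak{A}}=(\{(a_k,a_1,\dots,a_{k-1})\mid(a_1,\dots,a_k)\in\mathcal{T}^{\mathfrak{A}}\},k)$ and $(s\mathcal{T})^{\mathfrak{A}}=(\{(a_1,\dots,a_{k-2},a_k,a_{k-1})\mid(a_1,\dots,a_k)\in\mathcal{T}^{\mathfrak{A}}\},k)$;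 if $k\le1$ both equal $\mathcal{T}^{\mathfrak{A}}$. - If $k=\ell$: $(\mathcal{T}\setminus\mathcal{S})^{\mathfrak{A}}=(\{t\in A^k\mid t\in\mathcal{T}^{\mathfrak{A}},\ t\notin\mathcal{S}^{\mathfrak{A}}\},k)$; if $k\ne\ell$: $(\mathcal{T}\setminus\mathcal{S})^{\mathfrak{A}}=\mathcal{T}^{\mathfrak{A}}$. - Suffix intersection: $(\mathcal{T}\,\dot\cap\,\mathcal{S})^{\mathfrak{A}}=(\{(a_1,\dots,a_m)\in A^m\mid(a_{m-k+1},\dots,a_m)\in\mathcal{T}^{\mathfrak{A}}\text{ and }(a_{m-\ell+1},\dots,a_m)\in\mathcal{S}^{\mathfrak{A}}\},m)$, where $(a_{m+1},a_m)$ denotes $\epsilon$. - If $k\ge1$: $(\exists\mathcal{T})^{\mathfrak{A}}=(\{(a_1,\dots,a_{k-1})\mid(a_1,\dots,a_k)\in\mathcal{T}^{\mathfrak{A}}\text{ for some }a_k\in A\},k-1)$; if $k=0$: $(\exists\mathcal{T})^{\mathfrak{A}}=\mathcal{T}^{\mathfrak{A}}$. Formulas. $\mathrm{GF}$ is the fragment of first-order logic that has all atoms $R(x_1,\dots,x_k)$, $x=y$ and $x=x$, is closed under $\neg$ and $\wedge$, and in which existential quantification is restricted to patterns $\exists x_1\dots\exists x_k(\alpha\wedge\psi)$ where $\psi\in\mathrm{GF}$ and $\alpha$ is an atomic formula (a guard) having (at least) all the free variables of $\psi$. A sentence $\varphi$ defines $\varphi^{\mathfrak{A}}=(\{\epsilon\},0)$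 if $\mathfrak{A}\models\varphi$ and $\varphi^{\mathfrak{A}}=(\varnothing,0)$ otherwise. A sentence $\varphi$ and a term $\mathcal{T}$ are equivalent if $\varphi^{\mathfrak{A}}=\mathcal{T}^{\mathfrak{A}}$ for every model $\mathfrak{A}$ whose vocabulary contains all symbols of $\varphi$ and $\mathcal{T}$. *)

(* Defs.v *)
From mathcomp Require Import all_boot.
From mathcomp Require Import boolp classical_sets.

Set Implicit Arguments.
Unset Strict Implicit.
Unset Printing Implicit Defensive.

Local Open Scope classical_set_scope.

Record adrel (A : Type) := ADRel {
  ad_arity : nat;
  ad_set : set (ad_arity.-tuple A) }.

Arguments ADRel {A} ad_arity ad_set.
Arguments ad_set {A} a _.

(* Membership of a tuple given as a sequence; false if the length is not the
   arity. This avoids casts between tuple types of equal length. *)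
Definition ad_in A (s : seq A) (R : adrel A) : Prop :=
  exists2 t : (ad_arity R).-tuple A, ad_set R t & tval t = s.

Section Operators.
Variable A : Type.
Implicit Types R S : adrel A.

Definition ad_e : adrel A :=
  ADRel 2 [set t | exists a, tval t = [:: a; a]].

Definition ad_p R : adrel A :=
  if 2 <= ad_arity R then
    ADRel (ad_arity R)
      [set t | exists s a, ad_in (rcons s a) R /\ tval t = a :: s]
  else R.

Definition ad_s R : adrel A :=
  if 2 <= ad_arity R then
    ADRel (ad_arity R)
      [set t | exists s a b,
         ad_in (s ++ [:: a; b]) R /\ tval t = s ++ [:: b; a]]
  else R.

Definition ad_diff R S : adrel A :=
  if ad_arity R == ad_arity S then
    ADRel (ad_arity R) [set t | ad_in t R /\ ~ ad_in t S]
  else R.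

(* [drop (m - k) t] is the suffix of length [k] of the [m]-tuple [t]. *)
Definition ad_cap R S : adrel A :=
  let m := maxn (ad_arity R) (ad_arity S) in
  ADRel m
    [set t | ad_in (drop (m - ad_arity R) t) R /\
             ad_in (drop (m - ad_arity S) t) S].

Definition ad_exists R : adrel A :=
  if 1 <= ad_arity R then
    ADRel (ad_arity R).-1 [set t | exists a, ad_in (rcons t a) R]
  else R.

End Operators.

Arguments ad_e {A}.

(* The universe of all relation symbols; the vocabulary of a model is a subset
   of it. *)
Record signature := Signature {
  symbol :> Type;
  sym_arity : symbol -> nat }.

Record model (sg : signature) := Model {
  voc : set sg;
  dom : Type;
  dom_nonempty : inhabited dom;
  interp : forall R : sg, voc R -> set ((sym_arity R).-tuple dom) }.

Arguments interp {sg} m {R} _ _.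

(* Symbols outside the vocabulary are read as empty. Terms and formulas are
   only ever compared in models whose vocabulary contains all their symbols,
   so this convention is never used. *)
Definition rel_of sg (M : model sg) (R : sg) :
    set ((sym_arity R).-tuple (dom M)) :=
  [set t | exists h : voc M R, interp M h t].

Arguments rel_of {sg} M R _.

(* [TCap] is suffix intersection. *)
Inductive term (sg : signature) :=
| TRel of sg
| TE
| TP of term sg
| TS of term sg
| TDiff of term sg & term sg
| TCap of term sg & term sg
| TExists of term sg.

Arguments TE {sg}.

Section Terms.
Variable sg : signature.

Fixpoint arity (T : term sg) : nat :=
  match T with
  | TRel R => sym_arity R
  | TE => 2
  | TP T1 | TS T1 | TDiff T1 _ => arity T1
  | TCap T1 T2 => maxn (arity T1) (arity T2)
  | TExists T1 => (arity T1).-1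
  end.

Fixpoint term_syms (T : term sg) : set sg :=
  match T with
  | TRel R => [set R]
  | TE => set0
  | TP T1 | TS T1 | TExists T1 => term_syms T1
  | TDiff T1 T2 | TCap T1 T2 => term_syms T1 `|` term_syms T2
  end.

Fixpoint term_rel (M : model sg) (T : term sg) : adrel (dom M) :=
  match T with
  | TRel R => ADRel (sym_arity R) (rel_of M R)
  | TE => ad_e
  | TP T1 => ad_p (term_rel M T1)
  | TS T1 => ad_s (term_rel M T1)
  | TDiff T1 T2 => ad_diff (term_rel M T1) (term_rel M T2)
  | TCap T1 T2 => ad_cap (term_rel M T1) (term_rel M T2)
  | TExists T1 => ad_exists (term_rel M T1)
  end.

Lemma term_rel_arity (M : model sg) (T : term sg) :
  ad_arity (term_rel M T) = arity T.
Proof.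
elim: T => //= [T IH|T IH|T1 IH1 T2 IH2|T1 -> T2 ->|T IH] //.
- by rewrite /ad_p; case: ifP.
- by rewrite /ad_s; case: ifP.
- by rewrite /ad_diff; case: ifP.
- rewrite /ad_exists; case: ifP => /= [_|]; first by rewrite IH.
  by rewrite IH; case: (arity T).
Qed.

End Terms.

Inductive formula (sg : signature) :=
| FRel (R : sg) of (sym_arity R).-tuple nat
| FEq of nat & nat
| FNot of formula sg
| FAnd of formula sg & formula sg
| FEx of nat & formula sg.

Arguments FEq {sg}.

Section Formulas.
Variable sg : signature.

Fixpoint fv (f : formula sg) : seq nat :=
  match f with
  | FRel R xs => xs
  | FEq x y => [:: x; y]
  | FNot g => fv g
  | FAnd g h => fv g ++ fv h
  | FEx x g => [seq y <- fv g | y != x]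
  end.

Definition sentence (f : formula sg) : Prop := fv f = [::].

Fixpoint formula_syms (f : formula sg) : set sg :=
  match f with
  | FRel R _ => [set R]
  | FEq _ _ => set0
  | FNot g | FEx _ g => formula_syms g
  | FAnd g h => formula_syms g `|` formula_syms h
  end.

Definition atomic (f : formula sg) : Prop :=
  match f with FRel _ _ | FEq _ _ => True | _ => False end.

(* The quantified variables need not be distinct nor occur in the guard; the
   empty block only yields conjunctions. *)
Inductive GF : formula sg -> Prop :=
| GF_atom a : atomic a -> GF a
| GF_not f : GF f -> GF (FNot f)
| GF_and f g : GF f -> GF g -> GF (FAnd f g)
| GF_ex (xs : seq nat) a f :
    atomic a -> GF f -> {subset fv f <= fv a} ->
    GF (foldr (@FEx sg) (FAnd a f) xs).

Fixpoint sat (M : model sg) (v : nat -> dom M) (f : formula sg) : Prop :=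
  match f with
  | FRel R xs => rel_of M R (map_tuple v xs)
  | FEq x y => v x = v y
  | FNot g => ~ sat v g
  | FAnd g h => sat v g /\ sat v h
  | FEx x g => exists a : dom M, sat (fun y => if y == x then a else v y) g
  end.

Definition holds (M : model sg) (f : formula sg) : Prop :=
  forall v : nat -> dom M, sat v f.

Definition sentence_rel (M : model sg) (f : formula sg) : adrel (dom M) :=
  ADRel 0 (if `[< holds M f >] then [set [tuple]] else set0).

Definition equivalent (f : formula sg) (T : term sg) : Prop :=
  forall M : model sg, formula_syms f `|` term_syms T `<=` voc M ->
    sentence_rel M f = term_rel M T.

End Formulas.

(* Main.v *)
Require Import Defs.
From mathcomp Require Import all_boot.
From mathcomp Require Import boolp classical_sets.

Set Implicit Arguments.
Unset Strict Implicit.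
Unset Printing Implicit Defensive.

(** From formulas to terms: relative to a list [ys] of variables containing the
    free variables of a GF formula [f], and to a term restricting the values of
    [ys], the restriction of [f] is defined by a term. The list and the term
    come from the enclosing guard, or are empty and the true nullary term
    [TExists (TExists TE)] at the top. From terms to formulas: the tuples of a
    term all satisfy one atom containing its variables, which guards the
    quantifier that translates the operator [TExists]. *)

(** * Membership rules for the algebraic operators *)

Section AdMembership.
Variable A : Type.
Implicit Types (R S : adrel A) (s : seq A).

Lemma ad_in_size s R : ad_in s R -> size s = ad_arity R.
Proof. by case=> t _ <-; rewrite size_tuple. Qed.

Lemma ad_in_ADRel n (P : set (n.-tuple A)) (t : n.-tuple A) :
  ad_in t (ADRel n P) <-> P t.
Proof. by split=> [[u Pu /val_inj <-] //|Pt]; exists t. Qed.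

Lemma adrel_ext R S :
  ad_arity R = ad_arity S -> (forall s, ad_in s R <-> ad_in s S) -> R = S.
Proof.
case: R S => n P [m Q] /= nm; case: _ / nm Q => Q PQ.
by congr ADRel; apply/funext => t; apply/propext; rewrite -!ad_in_ADRel PQ.
Qed.

Lemma ad_in_e (x y : A) : ad_in [:: x; y] ad_e <-> x = y.
Proof.
split=> [[t /= [a ->] [-> ->]] //|->].
by exists [tuple y; y] => //=; exists y.
Qed.

(** The default branch of [ad_p] obeys the same rule: a one-element tuple is its own rotation, and
    longer tuples are excluded by their length. *)
Lemma ad_in_p a s R : ad_in (a :: s) (ad_p R) <-> ad_in (rcons s a) R.
Proof.
rewrite /ad_p; case: ifPn => [_|]; last first.
  rewrite -leqNgt => R1; case: s => [//|b s].
  by split=> /ad_in_size E; move: R1; rewrite -E ?size_rcons.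
split=> [[t /= [s' [b [sR E]]]]|sR]; first by rewrite E => -[<- <-].
have Es : size (a :: s) == ad_arity R.
  by rewrite -(ad_in_size sR) size_rcons.
by exists (Tuple Es) => //=; exists s, a.
Qed.

Lemma ad_in_s s a b R :
  ad_in (s ++ [:: b; a]) (ad_s R) <-> ad_in (s ++ [:: a; b]) R.
Proof.
rewrite /ad_s; case: ifPn => [_|]; last first.
  rewrite -leqNgt => R1.
  by split=> /ad_in_size E; move: R1; rewrite -E size_cat addnC.
split=> [[t /= [s' [c [d [sR ->]]]]]|sR].
  rewrite -[s' ++ _]cat_rcons -[s ++ [:: b; a]]cat_rcons !cats1.
  by move=> /rcons_inj[/rcons_inj[<- <-] <-].
have Es : size (s ++ [:: b; a]) == ad_arity R.
  by rewrite -(ad_in_size sR) !size_cat.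
by exists (Tuple Es) => //=; exists s, a, b.
Qed.

Lemma ad_in_diff s R S : ad_arity R = ad_arity S ->
  ad_in s (ad_diff R S) <-> ad_in s R /\ ~ ad_in s S.
Proof.
rewrite /ad_diff => RS; rewrite RS eqxx -RS.
split=> [[t /= tP <-] //|[]] [t tR <-] tS.
by exists t => //=; split=> //; exists t.
Qed.

Lemma ad_in_cap s R S :
  let m := maxn (ad_arity R) (ad_arity S) in size s = m ->
  ad_in s (ad_cap R S) <->
  ad_in (drop (m - ad_arity R) s) R /\ ad_in (drop (m - ad_arity S) s) S.
Proof.
move=> m /eqP sm; split=> [[t /= tP <-] //|sP].
by exists (Tuple sm).
Qed.

Lemma ad_in_exists s R : 0 < ad_arity R ->
  ad_in s (ad_exists R) <-> exists a, ad_in (rcons s a) R.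
Proof.
rewrite /ad_exists => R0; rewrite R0.
split=> [[t /= tP <-] //|[a aR]].
have Es : size s == (ad_arity R).-1.
  by rewrite -(ad_in_size aR) size_rcons.
by exists (Tuple Es) => //=; exists a.
Qed.

End AdMembership.

(** * Dependence of satisfaction on the assignment, and quantifier blocks *)

Section Coincidence.
Variables (sg : signature) (M : model sg).
Implicit Types (v w : nat -> dom M) (f g : formula sg).

Lemma sat_eq_in f v w : {in fv f, v =1 w} -> sat v f <-> sat w f.
Proof.
elim: f v w => [R xs|x y|g IH|g IHg h IHh|x g IH] v w /= vw.
- suff -> : map_tuple v xs = map_tuple w xs by [].
  by apply/val_inj/eq_in_map.
- by rewrite !vw // !inE eqxx ?orbT.
- by rewrite (IH v w).
- rewrite (IHg v w) ?(IHh v w) // => y yf; apply: vw;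
  by rewrite mem_cat yf ?orbT.
- suff E a : sat (fun y => if y == x then a else v y) g <->
             sat (fun y => if y == x then a else w y) g.
    by split=> -[a] /E ?; exists a.
  apply: IH => y yg; case: eqP => // /eqP yx.
  by apply: vw; rewrite mem_filter yx.
Qed.

Lemma sat_exs (xs : seq nat) g v :
  sat v (foldr (@FEx sg) g xs) <->
  exists2 w, (forall y, y \notin xs -> w y = v y) & sat w g.
Proof.
elim: xs v => [|x xs IH] v /=.
  split=> [vg|[w wv wg]]; first by exists v.
  by apply/(@sat_eq_in g w v) => // y _; apply: wv.
split=> [[a /IH[w wv wg]]|[w wv wg]].
  exists w => // y; rewrite inE negb_or => /andP[yx yxs].
  by rewrite wv // (negPf yx).
exists (w x); apply/IH; exists w => // y yxs.
by case: eqP => [-> //|/eqP yx]; apply: wv; rewrite inE negb_or yx.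
Qed.

End Coincidence.

Lemma fv_exs (sg : signature) (xs : seq nat) (g : formula sg) :
  fv (foldr (@FEx sg) g xs) = [seq y <- fv g | y \notin xs].
Proof.
elim: xs => [|x xs IH] /=; first by rewrite filter_predT.
by rewrite IH -filter_predI; apply: eq_filter => y; rewrite /= inE negb_or.
Qed.

(** * Closure properties of definability by terms, and the translation of formulas *)

Section Definable.
Variable sg : signature.

(** Properties of assignments are kept semantic, so that a restriction such as the constant [True]
    fits without a formula expressing it. *)
Definition vproperty := forall M : model sg, (nat -> dom M) -> Prop.
Implicit Types (P Q : vproperty) (xs ys : seq nat).

(* When [xs] has repetitions, only tuples with the corresponding repetitions
   are constrained. *)
Definition definable xs P : Prop :=
  exists2 T : term sg, arity T = size xs &
    forall (M : model sg) (v : nat -> dom M),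
      ad_in (map v xs) (term_rel M T) <-> P M v.

(** [TP] moves the last coordinate to the front; one application per entry of [ys] carries the whole
    block across. *)
Lemma definable_catC xs ys P : definable (xs ++ ys) P -> definable (ys ++ xs) P.
Proof.
elim/last_ind: ys xs => [|ys y IH] xs; first by rewrite cats0.
rewrite -rcons_cat cat_rcons => -[T aT defT]; apply: IH.
exists (TP T) => [|M v] /=; first by rewrite aT size_rcons.
by rewrite -defT map_rcons ad_in_p.
Qed.

(** [TS] acts on the last two coordinates only, so the pair is rotated to the end, swapped there and
    rotated back. *)
Lemma definable_swap xs x y ys P :
  definable (xs ++ x :: y :: ys) P -> definable (xs ++ y :: x :: ys) P.
Proof.
have cat2 (a b : nat) : xs ++ a :: b :: ys = (xs ++ [:: a; b]) ++ ys.
  by rewrite -catA.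
rewrite !cat2 => /definable_catC[T aT defT]; apply: definable_catC.
exists (TS T) => [|M v] /=; first by rewrite aT !size_cat.
by rewrite -defT !catA !map_cat ad_in_s.
Qed.

Lemma definable_perm xs ys P :
  perm_eq xs ys -> definable xs P -> definable ys P.
Proof.
(* Adjacent swaps carry [y] leftwards over the block [s]; sorting then proceeds as an insertion
   behind a fixed prefix [us]. *)
have move_left s y us ws :
    definable (us ++ s ++ y :: ws) P -> definable (us ++ y :: s ++ ws) P.
  elim: s us => [//|x s IH] us; rewrite /= -cat_rcons => /(IH (rcons us x)).
  by rewrite cat_rcons; apply: definable_swap.
suff perm_tail us : perm_eq xs ys ->
    definable (us ++ xs) P -> definable (us ++ ys) P by exact: (perm_tail [::]).
elim: ys xs us => [|y ys IH] xs us; first by move/perm_nilP ->.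
move=> xsP; have: y \in xs by rewrite (perm_mem xsP) mem_head.
move=> /splitPr xsE; case: xsE xsP => s1 s2 s12P /move_left.
rewrite -!cat_rcons; apply: IH.
by move: s12P; rewrite -cat1s perm_catCA perm_cons.
Qed.

(** Two copies of [x] are placed last and the last one is projected away. Where these coordinates
    differ, [definable] says nothing about [T]; the suffix intersection with [TE] discards such
    tuples first. *)
Lemma definable_dup x xs P :
  x \in xs -> definable (x :: xs) P -> definable xs P.
Proof.
move=> x_xs; have xsP := perm_to_rem x_xs.
have xxsP : perm_eq (x :: xs) (rem x xs ++ [:: x; x]).
  by rewrite perm_sym perm_catC /= !perm_cons perm_sym.
move=> /(definable_perm xxsP)[T aT defT].
suff: definable (rcons (rem x xs) x) P.
  by apply: definable_perm; rewrite perm_rcons perm_sym.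
have aTE : maxn (arity T) 2 = size (rem x xs) + 2.
  by rewrite aT size_cat; apply/maxn_idPl; rewrite leq_addl.
exists (TExists (TCap T TE)) => [|M v] /=.
  by rewrite aTE size_rcons addn2.
rewrite -defT ad_in_exists; last first.
  by rewrite /= term_rel_arity aTE addn2.
rewrite map_rcons map_cat /= -cats1.
have capE a :
    ad_in (rcons (map v (rem x xs) ++ [:: v x]) a) (ad_cap (term_rel M T) ad_e)
    <-> ad_in (map v (rem x xs) ++ [:: v x; a]) (term_rel M T) /\ v x = a.
  rewrite -cats1 -catA ad_in_cap; last first.
    by rewrite term_rel_arity aTE size_cat size_map.
  rewrite term_rel_arity aTE {1}aT size_cat subnn drop0 /= addnK.
  by rewrite drop_size_cat ?size_map // ad_in_e.
split=> [[a /capE[Pa xa]]|Pv]; first by rewrite -xa in Pa.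
by exists (v x); apply/capE.
Qed.

Lemma definable_undup xs P : definable xs P -> definable (undup xs) P.
Proof.
suff undup_tail us : definable (us ++ xs) P -> definable (us ++ undup xs) P.
  exact: (undup_tail [::]).
elim: xs us => //= x xs IH us; case: ifPn => [x_xs|_].
  move=> xs_def; apply: IH.
  apply: (@definable_dup x); first by rewrite mem_cat x_xs orbT.
  by apply: definable_perm xs_def; rewrite -cat1s perm_catCA.
by rewrite -!cat_rcons; apply: IH.
Qed.

(** Once the variables of [xs], without repetitions, form the end of the longer list, suffix
    intersection tests the second term on exactly these coordinates. Repetitions must go because
    [ys] may contain a variable fewer times than [xs]. *)
Lemma definable_and xs ys P Q : {subset xs <= ys} ->
  definable xs P -> definable ys Q ->
  definable ys (fun M v => Q M v /\ P M v).
Proof.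
move=> xs_ys /definable_undup[S aS defS].
have [zs ysP] : exists zs, perm_eq ys (zs ++ undup xs).
  have /count_subseqP[us us_ys usP] y :
      count_mem y (undup xs) <= count_mem y ys.
    rewrite count_uniq_mem ?undup_uniq // mem_undup.
    by case: (boolP (y \in xs)) => // /xs_ys; rewrite -has_pred1 has_count.
  have [zs ysP] := perm_to_subseq us_ys; exists zs.
  by rewrite (permPl ysP) perm_catC perm_cat2l perm_sym.
move=> /(definable_perm ysP)[T aT defT].
apply: (@definable_perm (zs ++ undup xs)); first by rewrite perm_sym.
have aTS : maxn (arity T) (arity S) = arity T.
  by apply/maxn_idPl; rewrite aT aS size_cat leq_addl.
exists (TCap T S) => [|M v] /=; first by rewrite aTS.
rewrite -defT -defS map_cat ad_in_cap; last first.
  by rewrite !term_rel_arity aTS aT !size_cat !size_map.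
rewrite !term_rel_arity aTS subnn drop0 aT aS size_cat addnK.
by rewrite drop_size_cat ?size_map.
Qed.

Lemma definable_diff ys P Q :
  definable ys P -> definable ys Q ->
  definable ys (fun M v => Q M v /\ ~ P M v).
Proof.
move=> [S aS defS] [T aT defT]; exists (TDiff T S) => // M v /=.
by rewrite -defT -defS ad_in_diff // !term_rel_arity aT aS.
Qed.

Lemma definable_ex x xs P : definable xs P ->
  definable [seq y <- undup xs | y != x]
    (fun M v => exists a, P M (fun y => if y == x then a else v y)).
Proof.
move=> /definable_undup xs_def.
have upd (M : model sg) (v : nat -> dom M) a zs : x \notin zs ->
    map (fun y => if y == x then a else v y) zs = map v zs.
  by move=> xz; apply/eq_in_map => y yz; case: eqP yz xz => // -> ->.
have [xxs|xxs] := boolP (x \in undup xs); last first.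
  have [T aT defT] := xs_def.
  have -> : [seq y <- undup xs | y != x] = undup xs.
    by apply/all_filterP/allP => y; apply: contraTneq => ->.
  exists T => // M v; rewrite defT.
  (* A property defined without the coordinate [x] is insensitive to updates of [x], so the same
     term serves. *)
  have PE a : P M v <-> P M (fun y => if y == x then a else v y).
    by rewrite -!defT upd.
  by split=> [/(PE (v x))|[a /PE]] //; exists (v x).
rewrite -rem_filter ?undup_uniq //.
have xsP := perm_to_rem xxs.
move: xs_def => /(@definable_perm _ (rcons (rem x (undup xs)) x)).
rewrite perm_sym perm_rcons perm_sym => /(_ xsP)[T aT defT].
(* With [x] absent from the other coordinates, an update of [x] affects only the projected one. *)
have xnin : x \notin rem x (undup xs).
  by rewrite mem_rem_uniqF ?undup_uniq.
exists (TExists T) => [|M v] /=; first by rewrite aT size_rcons.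
rewrite ad_in_exists ?term_rel_arity ?aT ?size_rcons //.
suff E a : ad_in (rcons (map v (rem x (undup xs))) a) (term_rel M T) <->
           P M (fun y => if y == x then a else v y).
  by split=> -[a /E]; exists a.
by rewrite -defT map_rcons upd // eqxx.
Qed.

(** The resulting list is controlled only as a set, since each quantifier removes repetitions; this
    is all that [definable_and] asks for. *)
Lemma definable_exs xs ys f : definable ys (fun _ v => sat v f) ->
  exists2 zs, zs =i [seq y <- ys | y \notin xs] &
    definable zs (fun _ v => sat v (foldr (@FEx sg) f xs)).
Proof.
move=> f_def; elim: xs => [|x xs [zs zsE zs_def]] /=.
  by exists ys => // y; rewrite mem_filter.
exists [seq y <- undup zs | y != x]; last exact: definable_ex zs_def.
by move=> y; rewrite !mem_filter mem_undup zsE mem_filter inE negb_or andbA.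
Qed.

Lemma definable_atom a : atomic a ->
  definable (fv a) (fun _ v => sat v a).
Proof.
case: a => //= [R xs|x y] _.
  exists (TRel R) => [|M v] /=; first by rewrite size_tuple.
  by rewrite -(ad_in_ADRel (rel_of M R)).
by exists TE => // M v /=; rewrite ad_in_e.
Qed.

Lemma definable_GF f ys P : GF f -> {subset fv f <= ys} -> definable ys P ->
  definable ys (fun _ v => P _ v /\ sat v f).
Proof.
move=> GFf; elim: GFf ys P =>
  {f}[a a_at|f _ IH|f g _ IHf _ IHg|xs a f a_at _ IH fa] ys P f_ys P_def.
- exact: (definable_and f_ys (definable_atom a_at)).
(* Removing [P] and [f] from [P] leaves [P] and not [f]. *)
- have [T aT defT] := definable_diff (IH _ _ f_ys P_def) P_def.
  exists T => // M v; rewrite defT /=; tauto.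
- have f_def : definable ys (fun _ v => P _ v /\ sat v f).
    by apply: IHf => // y yf; apply: f_ys; rewrite /= mem_cat yf.
  have [|T aT defT] := IHg _ _ _ f_def.
    by move=> y yg; apply: f_ys; rewrite /= mem_cat yg orbT.
  by exists T => // M v; rewrite defT /=; tauto.
(* The guard [a] becomes the restriction, over its own variables, which contain those of [f]. *)
- have af_def := IH _ _ fa (definable_atom a_at).
  have [zs zsE] := definable_exs xs (f := FAnd a f) af_def.
  move=> /definable_and; apply=> // y.
  rewrite zsE => y_a; apply: f_ys; move: y_a.
  by rewrite fv_exs /= filter_cat mem_cat => ->.
Qed.

(** The term side ignores the assignment, so a single assignment decides [holds]; the nonempty
    domain supplies one. *)
Lemma equivalent_nil f (T : term sg) : sentence f -> arity T = 0 ->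
  (forall M (v : nat -> dom M), sat v f <-> ad_in [::] (term_rel M T)) ->
  equivalent f T.
Proof.
move=> f_closed aT fT M _; apply: adrel_ext => [|s].
  by rewrite term_rel_arity.
have [d] := dom_nonempty M; pose v (_ : nat) := d.
have holdsE : holds M f <-> ad_in [::] (term_rel M T).
  by split=> [/(_ v)/fT|sT w] //; apply/fT.
have sE : ad_in s (term_rel M T) -> s = [::].
  by move=> /ad_in_size; rewrite term_rel_arity aT => /size0nil.
rewrite /sentence_rel; case: asboolP => [/holdsE sT|nT].
  by split=> [[t /= -> <-] //|/sE ->]; exists [tuple].
split=> [[]//|sT]; case: nT; apply/holdsE.
by rewrite -(sE sT).
Qed.

Lemma term_of_sentence f : GF f -> sentence f ->
  exists T : term sg, equivalent f T.
Proof.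
move=> GFf f_closed.
have true_def : definable [::] (fun _ _ => True).
  exists (TExists (TExists TE)) => // M v; split=> // _ /=.
  by do 2!(apply/ad_in_exists => //; exists (v 0)); apply/ad_in_e.
have [|T aT defT] := definable_GF GFf _ true_def; first by rewrite f_closed.
exists T; apply: equivalent_nil => // M v.
by have := defT M v; rewrite /=; tauto.
Qed.

(** * From terms to guarded formulas *)

Lemma guarded_formula_of_term (T : term sg) xs : size xs = arity T ->
  exists f a, [/\ GF f, {subset fv f <= xs}, atomic a, {subset xs <= fv a} &
    forall M (v : nat -> dom M),
      (sat v f <-> ad_in (map v xs) (term_rel M T)) /\
      (ad_in (map v xs) (term_rel M T) ->
         exists2 w, {in xs, w =1 v} & sat w a)].
Proof.
(* The list [xs] stays arbitrary, since permuting operators are translated by permuting variables.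
   The atom [a] may keep projected variables outside [xs], so it holds only after a change of
   assignment off [xs]. *)
elim: T xs => [R||T IH|T IH|T IHT S IHS|T IHT S IHS|T IH] xs /=.
- move=> /eqP xsR; pose a := FRel (Tuple xsR).
  have aE M (v : nat -> dom M) :
      sat v a <-> ad_in (map v xs) (ADRel _ (rel_of M R)).
    exact: iff_sym (ad_in_ADRel _ (map_tuple v (Tuple xsR))).
  exists a, a; split=> // [|M v]; first exact: GF_atom.
  by split=> // /aE; exists v.
- case: xs => [|x [|y []]] // _.
  have aE M (v : nat -> dom M) :
      sat v (@FEq sg x y) <-> ad_in (map v [:: x; y]) ad_e.
    by rewrite /= ad_in_e.
  exists (FEq x y), (FEq x y); split=> // [|M v]; first exact: GF_atom.
  by split=> // /aE; exists v.
- case: xs => [|x xs] szT.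
    have [f [a [? ? ? ? fa]]] := IH [::] szT; exists f, a; split=> // M v.
    by have := fa M v; rewrite /ad_p term_rel_arity -szT.
  have [|f [a [GFf f_xs a_at xs_a fa]]] := IH (rcons xs x).
    by rewrite size_rcons.
  exists f, a; split=> // [y /f_xs|y y_xs|M v]; first by rewrite mem_rcons.
    by apply: xs_a; rewrite mem_rcons.
  rewrite /= ad_in_p -map_rcons; have [fE aE] := fa M v; split=> // /aE[w wv].
  by exists w => // y y_xs; apply: wv; rewrite mem_rcons.
- move=> szT; have [szT2|] := ltnP (arity T) 2.
    have [f [a [? ? ? ? fa]]] := IH xs szT; exists f, a; split=> // M v.
    by have := fa M v; rewrite /ad_s term_rel_arity leqNgt szT2.
  rewrite -szT; case/lastP: xs szT => [//|xs x].
  case/lastP: xs => [//|xs y]; rewrite -cats1 cat_rcons => szT _.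
  have yxE : xs ++ [:: y; x] =i xs ++ [:: x; y].
    by move=> z; rewrite !mem_cat !inE (orbC (z == x)).
  have [|f [a [GFf f_xs a_at xs_a fa]]] := IH (xs ++ [:: x; y]).
    by rewrite -szT !size_cat.
  exists f, a; split=> // [z /f_xs|z|M v]; rewrite ?yxE //; first exact: xs_a.
  have := fa M v; rewrite !map_cat ad_in_s => -[fE aE]; split=> // /aE[w wv].
  by exists w => // z; rewrite yxE; apply: wv.
- move=> szT; have [f [a [GFf f_xs a_at xs_a fa]]] := IHT _ szT.
  (* For unequal arities the difference is its first argument. *)
  have [TS|TS] := eqVneq (arity T) (arity S); last first.
    exists f, a; split=> // M v; rewrite /ad_diff !term_rel_arity (negPf TS).
    exact: fa.
  have [|g [b [GFg g_xs _ _ gb]]] := IHS xs; first by rewrite -TS.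
  exists (FAnd f (FNot g)), a; split=> // [|y|M v].
  + by apply: GF_and => //; apply: GF_not.
  + by rewrite mem_cat => /orP[/f_xs|/g_xs].
  rewrite ad_in_diff ?term_rel_arity //=.
  have [fE aE] := fa M v; have [gE _] := gb M v.
  by rewrite fE gE; split=> // -[/aE].
- set m := maxn _ _ => szm.
  have szd (U : term sg) : arity U <= m ->
      size (drop (m - arity U) xs) = arity U.
    by move=> Um; rewrite size_drop szm subKn.
  have [f [a [GFf f_xs a_at xs_a fa]]] := IHT _ (szd T (leq_maxl _ _)).
  have [g [b [GFg g_xs b_at xs_b gb]]] := IHS _ (szd S (leq_maxr _ _)).
  have capE M (v : nat -> dom M) :
      ad_in (map v xs) (ad_cap (term_rel M T) (term_rel M S)) <->
      ad_in (map v (drop (m - arity T) xs)) (term_rel M T) /\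
      ad_in (map v (drop (m - arity S) xs)) (term_rel M S).
    by rewrite ad_in_cap ?term_rel_arity ?size_map // !map_drop.
  suff [c [c_at xs_c capc]] : exists c, [/\ atomic c, {subset xs <= fv c} &
      forall M (v : nat -> dom M),
        ad_in (map v xs) (ad_cap (term_rel M T) (term_rel M S)) ->
        exists2 w, {in xs, w =1 v} & sat w c].
    exists (FAnd f g), c; split=> // [|y|M v].
    + exact: GF_and.
    + by rewrite mem_cat => /orP[/f_xs|/g_xs] /mem_drop.
    split; last exact: capc.
    by rewrite capE /=; have [-> _] := fa M v; have [-> _] := gb M v.
  (* The argument of larger arity reads all of [xs], so its atom covers [xs]. *)
  have [ST|TS] := leqP (arity S) (arity T).
    have m0 : m - arity T = 0 by rewrite /m (maxn_idPl ST) subnn.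
    rewrite m0 drop0 in xs_a fa capE.
    exists a; split=> // M v /capE[vT _].
    by have [_] := fa M v; apply.
  have m0 : m - arity S = 0 by rewrite /m (maxn_idPr (ltnW TS)) subnn.
  rewrite m0 drop0 in xs_b gb capE.
  exists b; split=> // M v /capE[_ vS].
  by have [_] := gb M v; apply.
- move=> szT; have [T0|T0] := posnP (arity T).
    have [|f [a [? ? ? ? fa]]] := IH xs; first by rewrite szT T0.
    exists f, a; split=> // M v.
    by have := fa M v; rewrite /ad_exists term_rel_arity T0.
  (* A variable fresh for [xs] names the projected coordinate. *)
  pose z := (\max_(x <- xs) x).+1.
  have z_xs : z \notin xs.
    apply/negP => z_xs.
    by have := leq_bigmax_seq (P := predT) (F := id) z z_xs isT; rewrite ltnn.
  have [|f [a [GFf f_xs a_at xs_a fa]]] := IH (rcons xs z).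
    by rewrite size_rcons szT prednK.
  have fv_fa : {subset fv f <= fv a} by move=> y /f_xs /xs_a.
  (* The block binds every variable of [a] outside [xs], not only [z]: older projected variables in
     the guard must be free to change too. *)
  pose zs := [seq y <- fv a | y \notin xs].
  have zsN y : y \in xs -> y \notin zs by rewrite mem_filter negb_and => ->.
  have exE M (v : nat -> dom M) :
      ad_in (map v xs) (ad_exists (term_rel M T)) ->
      exists w, [/\ {in xs, w =1 v}, sat w a & sat w f].
    move=> /ad_in_exists[|d]; rewrite ?term_rel_arity //.
    pose u y := if y == z then d else v y.
    have uv : {in xs, u =1 v}.
      by move=> y; rewrite /u; case: eqP => // ->; rewrite (negPf z_xs).
    have -> : rcons (map v xs) d = map u (rcons xs z).
      by rewrite map_rcons (iffLR (eq_in_map _ _ _) uv) /u eqxx.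
    move=> uT; have [uf /(_ uT)[w wu wa]] := fa M u; exists w; split=> //.
      by move=> y y_xs; rewrite wu ?uv // mem_rcons inE y_xs orbT.
    by apply/(@sat_eq_in _ M f w u); [move=> y /f_xs /wu|apply/uf].
  exists (foldr (@FEx sg) (FAnd a f) zs), a; split=> //.
  + exact: GF_ex.
  + move=> y; rewrite fv_exs mem_filter mem_cat mem_filter negb_and negbK.
    move=> /andP[+ ya]; have -> : y \in fv a by case/orP: ya => // /fv_fa.
    by rewrite orbF.
  + by move=> y y_xs; apply: xs_a; rewrite mem_rcons inE y_xs orbT.
  move=> M v; split; last by move=> /exE[w [wv wa _]]; exists w.
  rewrite sat_exs; split=> [[w wv /= [_ wf]]|/exE[w [wv wa wf]]].
    have wT := iffLR (fa M w).1 wf.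
    apply/ad_in_exists; first by rewrite term_rel_arity.
    exists (w z); rewrite map_rcons in wT.
    by rewrite -(iffLR (eq_in_map w v xs)) // => y /zsN /wv.
  (* The assignment [w] matches [v] only on [xs], while the block allows changes only on [zs]. The
     patched assignment agrees with [w] on [a], whose variables lie in [xs] or [zs]. *)
  exists (fun y => if y \in zs then w y else v y) => [y /negPf -> //|].
  have wE : {in fv a, (fun y => if y \in zs then w y else v y) =1 w}.
    move=> y ya; rewrite mem_filter ya andbT.
    by case: ifPn => // /negPn /wv ->.
  split; first by apply/(sat_eq_in wE).
  by apply/(@sat_eq_in _ M f _ w) => // y /fv_fa /wE.
Qed.

Lemma sentence_of_term (T : term sg) : arity T = 0 ->
  exists f : formula sg, [/\ GF f, sentence f & equivalent f T].
Proof.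
move=> T0.
have [f [? [GFf f0 _ _ fT]]] := guarded_formula_of_term (xs := [::]) (esym T0).
have f_closed : sentence f.
  by rewrite /sentence; case: (fv f) f0 => // y s /(_ y (mem_head _ _)).
by exists f; split=> //; apply: equivalent_nil => // M v; have [] := fT M v.
Qed.

End Definable.

Theorem theorem4p3 (sg : signature) :
  (forall f : formula sg, GF f -> sentence f ->
     exists T : term sg, equivalent f T) /\
  (forall T : term sg, arity T = 0 ->
     exists f : formula sg, [/\ GF f, sentence f & equivalent f T]).
Proof. by split; [apply: term_of_sentence|apply: sentence_of_term]. Qed.
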